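(* Let $(l_i)_{i\ge 0}$, $(m_i)_{i\ge 0}$, $(n_i)_{i\ge 0}$ be three strictly increasing sequences of positive integers such that $l_i<m_i<n_i$ for all $i$, $\frac{m_i}{l_i}$ increases exponentially to $+\infty$, and $\frac{n_i}{m_i}$ increases exponentially to $+\infty$. Define finite words over $\{0,1\}$ by $u_0=0$, $v_0=1$ and, for all $i\ge 0$, $u_{i+1}=u_i^{m_i}v_i^{l_i}$ and $v_{i+1}=u_i^{m_i}v_i^{n_i}$. Let $u$ be the infinite word over $\{0,1\}$ to which the sequence $(u_i)$ converges (each $u_i$ is a prefix of $u_{i+1}$, and $u$ is the infinite word having every $u_i$ as a prefix). Then $u$ is uniformly recurrent.
   Context: Words are over the alphabet $\{0,1\}$; $w^n$ is the concatenation of $n$ copies of the finite word $w$. A sequence $(r_i)$ of positive reals ''increases exponentially to $+\infty$'' means it is increasing and there are constants $c>0$, $q>1$ with $r_i\ge c\,q^i$ for all $i$. A factor of an infinite word is a finite block of consecutive letters occurring in it. An infinite word $u$ is uniformly recurrent if for every $n\in\mathbb{N}$ there exists $N$ such that every factor of $u$ of length $N$ contains (as factors) all the factors of $u$ of length $n$. *)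

(* Defs.v *)
From HB Require Import structures.
From mathcomp Require Import all_boot all_order all_algebra.
From mathcomp Require Import reals.

Set Implicit Arguments.
Unset Strict Implicit.
Unset Printing Implicit Defensive.

Import Order.TTheory GRing.Theory Num.Theory.

(* The letters 0 and 1 are encoded as false and true. *)
Definition word := seq bool.
Definition iword := nat -> bool.

Definition wexp (w : word) (n : nat) : word := flatten (nseq n w).

(* "Increasing" is taken in the non-strict sense, the weaker hypothesis.
   Positivity of r follows from the lower bound. *)
Definition increases_exponentially (R : realType) (r : nat -> R) : Prop :=
  {homo r : i j / (i <= j)%N >-> (i <= j)%R} /\
  exists c q : R, [/\ (0 < c)%R, (1 < q)%R & forall i, (c * q ^+ i <= r i)%R].

(* The i-th value is the pair (u_i, v_i). *)
Fixpoint uv (l m n : nat -> nat) (i : nat) : word * word :=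
  if i is j.+1 then
    let: (u, v) := uv l m n j in
    (wexp u (m j) ++ wexp v (l j), wexp u (m j) ++ wexp v (n j))
  else ([:: false], [:: true]).

Definition uword (l m n : nat -> nat) (i : nat) : word := (uv l m n i).1.
Definition vword (l m n : nat -> nat) (i : nat) : word := (uv l m n i).2.

Definition block (u : iword) (p k : nat) : word := mkseq (fun j => u (p + j)) k.

Definition iprefix (w : word) (u : iword) : Prop := block u 0 (size w) = w.

Definition ifactor (w : word) (u : iword) : Prop :=
  exists p, block u p (size w) = w.

Definition uniformly_recurrent (u : iword) : Prop :=
  forall n : nat, exists N : nat,
    forall w : word, ifactor w u -> size w = N ->
    forall x : word, ifactor x u -> size x = n -> infix x w.

Lemma uwordS l m n i : uword l m n i.+1 =
  wexp (uword l m n i) (m i) ++ wexp (vword l m n i) (l i).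
Proof. by rewrite /uword /vword /=; case: (uv l m n i). Qed.

Lemma vwordS l m n i : vword l m n i.+1 =
  wexp (uword l m n i) (m i) ++ wexp (vword l m n i) (n i).
Proof. by rewrite /uword /vword /=; case: (uv l m n i). Qed.

Lemma size_wexp w k : size (wexp w k) = k * size w.
Proof. by elim: k => //= k IH; rewrite size_cat -/(wexp w k) IH mulSn. Qed.

Lemma prefix_uwordS l m n i : 0 < m i ->
  prefix (uword l m n i) (uword l m n i.+1).
Proof. by rewrite uwordS; case: (m i) => // k _; rewrite /= -catA prefix_prefix. Qed.

(* The limit word exists and is unique, so quantifying over the infinite words
   that have every u_i as a prefix is quantifying over exactly one word. *)
Lemma limit_word_exists_unique (l m n : nat -> nat) :
  (forall i, 0 < l i) -> (forall i, 0 < m i) ->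
  exists u : iword, (forall i, iprefix (uword l m n i) u) /\
    forall u' : iword, (forall i, iprefix (uword l m n i) u') -> u' =1 u.
Proof.
move=> l0 m0.
have szuv i : i < size (uword l m n i) /\ 0 < size (vword l m n i).
  elim: i => [//|i [IHu IHv]]; rewrite uwordS vwordS !size_cat !size_wexp.
  have := m0 i; have := l0 i; case: (m i) (l i) => // a [] // b _ _.
  rewrite !mulSn; split; last first.
    by rewrite -addnA addn_gt0 (leq_ltn_trans _ IHu).
  rewrite -addn1; apply: leq_add; first exact: leq_trans IHu (leq_addr _ _).
  exact: leq_trans IHv (leq_addr _ _).
have pre i d : prefix (uword l m n i) (uword l m n (d + i)).
  elim: d => [|d IH]; first exact: prefix_refl.
  exact: prefix_trans IH (prefix_uwordS _ _ (m0 _)).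
have nthp i j k : i <= j -> k < size (uword l m n i) ->
    nth false (uword l m n j) k = nth false (uword l m n i) k.
  move=> ij ki; have /prefixP [s] := pre i (j - i).
  by rewrite subnK // => ->; rewrite nth_cat ki.
exists (fun k => nth false (uword l m n k) k); split=> [i|u' pu' k].
  apply: (@eq_from_nth _ false); rewrite size_mkseq // => k ki.
  rewrite nth_mkseq //= add0n; case: (leqP i k) => ik; first exact: nthp.
  by rewrite -(nthp k i) ?(ltnW ik) //; case: (szuv k).
by rewrite -(pu' k) nth_mkseq //; case: (szuv k).
Qed.

(* Main.v *)
Require Import Defs.
From HB Require Import structures.
From mathcomp Require Import all_boot all_order all_algebra.
From mathcomp Require Import reals.
From mathcomp Require boolp.

(** The factors of a given length are finitely many, so they all lie in one
    [u_i].  Since [u_i] begins both [u_(i+1)] and [v_(i+1)], and [u] is a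
    concatenation of copies of these two words, a window of [u] more than twice
    as long as both contains a whole copy of one of them, hence [u_i]. *)

(** Dropping leading pieces, one may assume that the window starts inside the first piece. The rest
    of that piece and the whole next one have total length at most [M.*2], so the next piece lies in
    the window. The extra letter excludes an empty [ss] even when [M = 0]. *)
Lemma infix_flatten_window (T : eqType) (y : seq T) (M p : nat)
    (ss : seq (seq T)) :
  {in ss, forall s, size s <= M} -> {in ss, forall s, infix y s} ->
  p + M.*2.+1 <= size (flatten ss) ->
  infix y (take M.*2.+1 (drop p (flatten ss))).
Proof.
elim: ss p => [|s ss IH] p; first by rewrite addnS.
move=> /forall_cons [sM ssM] /forall_cons [_ yss] /=.
rewrite size_cat drop_cat; case: ltnP => [ps|sp] le_p; last first.
  by apply: IH => //; rewrite addnBAC // leq_subLR.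
(* A next piece [t] exists, since a single piece is too short to hold the window. *)
case: ss ssM yss le_p {IH} => [|t ss] /=.
  move=> _ _; rewrite addn0 => /(leq_trans (leq_addl _ _)).
  by rewrite leqNgt ltnS (leq_trans sM) // -addnn leq_addr.
move=> /forall_cons [tM _] /forall_cons [yt _] _.
have st : size (drop p s ++ t) <= M.*2.+1.
  rewrite size_cat size_drop leqW // -addnn leq_add //.
  exact: leq_trans (leq_subr _ _) sM.
by rewrite catA take_cat ltnNge st /= -catA infix_catl // infix_catr.
Qed.

Definition concat_of (a b w : word) : Prop :=
  exists2 ss : seq word, {subset ss <= [:: a; b]} & w = flatten ss.

Lemma concat_of_cat a b w1 w2 :
  concat_of a b w1 -> concat_of a b w2 -> concat_of a b (w1 ++ w2).
Proof.
move=> [s1 sub1 ->] [s2 sub2 ->]; exists (s1 ++ s2); last by rewrite flatten_cat.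
by move=> x; rewrite mem_cat => /orP [/sub1|/sub2].
Qed.

Lemma concat_of_wexp a b w k : concat_of a b w -> concat_of a b (wexp w k).
Proof.
move=> abw; elim: k => [|k IH]; first by exists [::].
exact: concat_of_cat abw IH.
Qed.

(** Letting [d] grow cuts arbitrarily long prefixes of the limit word into words of the fixed level
    [i]. *)
Lemma concat_of_uv (l m n : nat -> nat) i d :
  concat_of (uword l m n i) (vword l m n i) (uword l m n (d + i)) /\
  concat_of (uword l m n i) (vword l m n i) (vword l m n (d + i)).
Proof.
elim: d => [|d [IHu IHv]].
  split; [exists [:: uword l m n i]|exists [:: vword l m n i]];
    by rewrite /= ?cats0 // => x; rewrite !inE => /eqP ->; rewrite eqxx ?orbT.
by rewrite addSn uwordS vwordS; split; apply: concat_of_cat; apply: concat_of_wexp.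
Qed.

Lemma infix_uword_vwordS (l m n : nat -> nat) i :
  0 < m i -> infix (uword l m n i) (vword l m n i.+1).
Proof.
by rewrite vwordS; case: (m i) => // k _; rewrite /= -catA prefix_infix.
Qed.

Lemma size_vword_gt0 (l m n : nat -> nat) i :
  (forall j, 0 < n j) -> 0 < size (vword l m n i).
Proof.
move=> n_pos; elim: i => [//|i IHi].
by rewrite vwordS size_cat !size_wexp addn_gt0 !muln_gt0 n_pos IHi orbT.
Qed.

(** This crude bound names explicitly a level whose word reaches past a given position. *)
Lemma size_uword (l m n : nat -> nat) i :
  (forall j, 0 < l j) -> (forall j, 0 < m j) -> (forall j, 0 < n j) ->
  i < size (uword l m n i).
Proof.
move=> l_pos m_pos n_pos; elim: i => [//|i IHi].
rewrite uwordS size_cat !size_wexp -addn1 leq_add //.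
  by rewrite (leq_trans IHi) // leq_pmull.
by rewrite muln_gt0 l_pos size_vword_gt0.
Qed.

Lemma block_iprefix (w : word) (u : iword) p k :
  iprefix w u -> p + k <= size w -> block u p k = take k (drop p w).
Proof.
move=> <-; rewrite size_mkseq => pk.
apply: (@eq_from_nth _ false).
  rewrite size_mkseq size_takel // size_drop size_mkseq leq_subRL //.
  exact: leq_trans (leq_addr _ _) pk.
rewrite size_mkseq => j jk.
rewrite nth_take // nth_drop !nth_mkseq //.
by rewrite (leq_trans _ pk) // ltn_add2l.
Qed.

Lemma ifactor_bounded (u : iword) (s : seq word) :
  exists P, {in s, forall x, ifactor x u ->
    exists2 p, p <= P & block u p (size x) = x}.
Proof.
elim: s => [|x s [P sP]]; first by exists 0.
(* Occurring in an infinite word is not decidable, hence the classical case split. *)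
case: (boolp.EM (ifactor x u)) => [[p px]|nx]; last first.
  by exists P => y; rewrite inE => /orP [/eqP ->|/sP].
exists (maxn p P) => y; rewrite inE => /orP [/eqP -> _|/sP yP /yP [q qP qy]].
  by exists p => //; apply: leq_maxl.
by exists q => //; rewrite leq_max qP orbT.
Qed.

(** There are only finitely many binary words of length [n], so one bound serves them all. *)
Lemma ifactor_size_bounded (u : iword) n :
  exists P, forall x, ifactor x u -> size x = n ->
    exists2 p, p <= P & block u p n = x.
Proof.
have [P uP] := ifactor_bounded u [seq val t | t : n.-tuple bool].
exists P => x xu xn; rewrite -xn; apply: uP => //.
by rewrite -[x](val_tcast xn (in_tuple x)) image_f.
Qed.

Theorem theorem3p1 (R : realType) (l m n : nat -> nat)
    (l_pos : forall i, 0 < l i)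
    (m_pos : forall i, 0 < m i)
    (n_pos : forall i, 0 < n i)
    (l_incr : {homo l : i j / i < j})
    (m_incr : {homo m : i j / i < j})
    (n_incr : {homo n : i j / i < j})
    (lt_lm : forall i, l i < m i)
    (lt_mn : forall i, m i < n i)
    (ml_exp : increases_exponentially (fun i => ((m i)%:R / (l i)%:R : R)%R))
    (nm_exp : increases_exponentially (fun i => ((n i)%:R / (m i)%:R : R)%R))
    (u : iword)
    (u_lim : forall i, iprefix (uword l m n i) u) :
  uniformly_recurrent u.
Proof.
move=> k; have [P uP] := ifactor_size_bounded u k.
(* Each factor of length [k] has an occurrence ending by position [P + k], and [uword l m n i] is
   longer than that. *)
pose i := P + k.
(* The pieces are taken at level [i.+1], where both kinds contain [uword l m n i]. *)
pose M := maxn (size (uword l m n i.+1)) (size (vword l m n i.+1)).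
exists M.*2.+1 => w [p <-]; rewrite size_mkseq => -> x xu xk.
have {xu xk} xi : infix x (uword l m n i).
  have [q qP <-] := uP x xu xk.
  rewrite (@block_iprefix _ _ _ _ (u_lim i)); last first.
    by rewrite (leq_trans _ (ltnW (size_uword _ _ _ i l_pos m_pos n_pos))) // leq_add2r.
  exact: prefix_infix_trans (prefix_take _ _) (infix_drop _ _).
apply: infix_trans xi _.
(* The window ends at position [d], so it lies in the word of level [d + i.+1]. *)
pose d := p + M.*2.+1.
have le_d : d <= size (uword l m n (d + i.+1)).
  by rewrite (leq_trans (leq_addr i.+1 d)) // ltnW // size_uword.
rewrite (@block_iprefix _ _ _ _ (u_lim (d + i.+1))) //.
have [[ss sub def_u] _] := concat_of_uv l m n i.+1 d.
rewrite {}def_u in le_d *.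
apply: infix_flatten_window le_d.
- by move=> s /sub; rewrite !inE => /orP [] /eqP ->; rewrite leq_max leqnn ?orbT.
- move=> s /sub; rewrite !inE => /orP [] /eqP ->.
    exact/prefixW/prefix_uwordS.
  exact: infix_uword_vwordS.
Qed.
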